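(* Let $X$ be a finite simplicial complex and $A$ a subcomplex of $X$. For $k\ge 1$ (with $X_k\setminus A_k\neq\emptyset$, so that $\mu_k(X,A)$ is defined), $$\mu_k(X,A)\ \geq\ \mu_k(X)-\max_{\sigma\in X_k\setminus A_k}\big(|\sigma_{k-1}\cap A_{k-1}|+|\{\tau\in X_k\setminus A_k:\tau\cap\sigma\in A_{k-1}\}|\big).$$ Consequently, if $$\mu_k(X)>\max_{\sigma\in X_k\setminus A_k}\big(|\sigma_{k-1}\cap A_{k-1}|+|\{\tau\in X_k\setminus A_k:\tau\cap\sigma\in A_{k-1}\}|\big),$$ then $H_k(X,A;\mathbb{R})=0$.
   Context: A simplicial complex $X$ is a finite collection of finite sets closed under taking subsets, always containing $\emptyset$; $\dim\sigma=|\sigma|-1$; $X_k$ is the set of $k$-dimensional faces; $V(X)$ is the union of all faces. For $\sigma\in X_k$, $\sigma_{k-1}=\{\tau\in X_{k-1}:\tau\subseteq\sigma\}$. Fix a total order on $V(X)$. $C_k(X;\mathbb{R})$ is the real vector space with basis $X_k$ ($k\geq -1$), and $\partial_k(X;\mathbb{R})[\sigma]=\sum_{i=0}^k(-1)^i[\sigma\setminus\{v_i\}]$ for $\sigma=\{v_0\prec\dots\prec v_k\}$. $C_k(X,A;\mathbb{R})=C_k(X;\mathbb{R})/C_k(A;\mathbb{R})$ is identified with the real vector space with basis $X_k\setminus A_k$, and the relative boundary map $\partial_k(X,A;\mathbb{R})$ is given by the same formula, omitting the terms with $\sigma\setminus\{v_i\}\in A_{k-1}$. $H_k(X,A;\mathbb{R})=\ker\partial_k(X,A;\mathbb{R})/\operatorname{im}\partial_{k+1}(X,A;\mathbb{R})$.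 With adjoints (transposes) with respect to these bases, $L_k(X)=\partial_{k+1}\partial_{k+1}^*+\partial_k^*\partial_k$ (using the maps of $X$), $L_k(X,A)=\partial_{k+1}\partial_{k+1}^*+\partial_k^*\partial_k$ (using the relative maps), and $\mu_k(X)$, $\mu_k(X,A)$ are their respective smallest eigenvalues. *)

(* Defs.v *)
From HB Require Import structures.
From mathcomp Require Import all_boot all_order all_algebra.
From mathcomp Require Import generic_quotient ring_quotient.
From mathcomp Require Import boolp classical_sets reals.

Set Implicit Arguments.
Unset Strict Implicit.
Unset Printing Implicit Defensive.

Import Order.TTheory GRing.Theory Num.Theory.

Local Open Scope ring_scope.

(* A finite simplicial complex is a set of faces {set {set T}} over a finite,
   totally ordered type T.  V(X) = cover X need not be all of T; the total
   order on V(X) is the restriction of the order of T. *)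
Definition simplicial_complex (T : finType) (X : {set {set T}}) : Prop :=
  finset.set0 \in X /\
  forall s t : {set T}, s \in X -> t \subset s -> t \in X.

(* Faces are indexed by their number of vertices, not by their dimension, so
   that dimension -1 is available: X_k is [faces X k.+1] and X_{k-1} is
   [faces X k]. *)
Definition faces (T : finType) (X : {set {set T}}) (n : nat) : {set {set T}} :=
  [set s in X | #|s| == n].

Definition relfaces (T : finType) (X A : {set {set T}}) (n : nat) :
  {set {set T}} := faces X n :\: faces A n.

Section Chains.

Variables (R : realType) (d : Order.disp_t) (T : finOrderType d).
Implicit Types (s t : {set T}) (F G : {set {set T}}) (X A : {set {set T}}).

(* The coefficient of [t] in \sum_i (-1)^i [s \ {v_i}].  The index i of a
   vertex v = v_i of s is the number of vertices of s smaller than v. *)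
Definition incidence s t : R :=
  \sum_(v in s | s :\ v == t) (-1) ^+ #|[set u in s | (u < v)%O]|.

(* The matrix, in the bases F and G and acting on column vectors, of
   [s] |-> \sum_i (-1)^i [s \ {v_i}], omitting the terms outside G. *)
Definition boundary_mx F G : 'M[R]_(#|G|, #|F|) :=
  \matrix_(i, j) incidence (enum_val j) (enum_val i).

Definition boundary X k : 'M[R]_(#|faces X k|, #|faces X k.+1|) :=
  boundary_mx (faces X k.+1) (faces X k).

Definition relboundary X A k :
    'M[R]_(#|relfaces X A k|, #|relfaces X A k.+1|) :=
  boundary_mx (relfaces X A k.+1) (relfaces X A k).

Definition laplacian X k : 'M[R]_#|faces X k.+1| :=
  boundary X k.+1 *m (boundary X k.+1)^T + (boundary X k)^T *m boundary X k.

Definition rellaplacian X A k : 'M[R]_#|relfaces X A k.+1| :=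
  relboundary X A k.+1 *m (relboundary X A k.+1)^T
  + (relboundary X A k)^T *m relboundary X A k.

(* [eigenvalue] uses row eigenvectors, which gives the same eigenvalues.
   Defaults to 0 if there is no smallest eigenvalue; this does not happen for
   a symmetric matrix of positive size. *)
Definition min_eigenvalue (n : nat) (M : 'M[R]_n) : R :=
  xget 0 [set a | eigenvalue M a /\
                  forall b, eigenvalue M b -> a <= b]%classic.

Definition mu X k : R := min_eigenvalue (laplacian X k).

Definition relmu X A k : R := min_eigenvalue (rellaplacian X A k).

Definition relcycles X A k : {vspace 'cV[R]_#|relfaces X A k.+1|} :=
  lker (linfun (mulmx (relboundary X A k))).

Definition relboundaries X A k : {vspace 'cV[R]_#|relfaces X A k.+1|} :=
  limg (linfun (mulmx (relboundary X A k.+1))).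

(* As the boundaries are cycles (for X and A complexes), this is the subspace
   of boundaries seen inside the space of cycles. *)
Definition relboundary_pred X A k : {pred subvs_of (relcycles X A k)} :=
  [pred z | vsval z \in relboundaries X A k].
Arguments relboundary_pred : clear implicits.

Fact relboundary_pred_zmod X A k : zmod_closed (relboundary_pred X A k).
Proof.
split=> [|u v]; rewrite !inE ?linear0 ?mem0v // => Hu Hv.
by rewrite linearB rpredB.
Qed.

HB.instance Definition _ X A k :=
  GRing.isZmodClosed.Build _ (relboundary_pred X A k)
    (relboundary_pred_zmod X A k).

(* H_k(X,A) = ker / im, as a quotient of additive groups; its scalar action is
   not needed to say that it is 0. *)
Definition relhomology X A k : zmodType := Quotient.quot (relboundary_pred X A k).

End Chains.

(* For s a face of dimension k: [subfaces X s k] is s_{k-1}. *)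
Definition subfaces (T : finType) (X : {set {set T}}) (s : {set T}) (n : nat) :
  {set {set T}} := [set t in faces X n | t \subset s].

Definition max_overlap (T : finType) (X A : {set {set T}}) (k : nat) : nat :=
  \max_(s in relfaces X A k.+1)
    (#|subfaces X s k :&: faces A k|
     + #|[set t in relfaces X A k.+1 | t :&: s \in faces A k]|).

(* Main.v *)
Require Import Defs.
From mathcomp Require Import all_boot all_order all_algebra.
From mathcomp Require Import generic_quotient ring_quotient reals ring complex.
From mathcomp Require classical_sets.

(** Write S for the set of k-faces of X outside A.  A chain f supported on S can be
    tested both by the Laplacian of X and by the relative one; each
    quadratic form is a sum of squares, one per (k+1)-face and one per
    (k-1)-face ([hodge_energyE]).  The (k+1)-faces of A contribute nothing to
    the first form, since all their k-faces lie in A, so the two forms differ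
    exactly by the squares indexed by the (k-1)-faces t of A
    ([hodge_energy_compare]):

      E_X(f) = E_(X,A)(f) + \sum_(t in A_(k-1)) (\sum_(s in S) f(s) [s : t])^2.

    The last sum is the quadratic form of B^T B, where B is the boundary map
    from S to A_(k-1).  It is at most |f|^2 times the largest absolute row sum
    of B^T B.  The row of s gets 1 from s itself for each facet of s in A, and
    at most 1 from each other face r of S, only when r and s share a facet in
    A, which is then their intersection: in total this is the overlap of the
    theorem ([overlap_bound], [sum_overlap_le]).

    Since E_X(f) >= mu_k(X) |f|^2 by the spectral theorem ([min_eigenvalueP]),
    E_(X,A)(f) >= (mu_k(X) - overlap) |f|^2, and testing on an eigenvector
    gives the eigenvalue bound.  If mu_k(X) exceeds the overlap, the relative
    Laplacian is invertible, and then every relative cycle is a boundary by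
    the Hodge argument of [hodge_exact], which uses that the relative maps form
    a chain complex ([relboundary_comp0]). *)

Set Implicit Arguments.
Unset Strict Implicit.
Unset Printing Implicit Defensive.

Import Order.TTheory GRing.Theory Num.Theory.
Local Open Scope ring_scope.

(** * Least eigenvalues of real symmetric matrices *)

Section Spectral.

Local Open Scope sesquilinear_scope.

Lemma diag_formE (C : numClosedFieldType) n (D w : 'rV[C]_n) :
  (w *m diag_mx D *m w ^t*) 0 0 = \sum_i D 0 i * `|w 0 i| ^+ 2.
Proof.
rewrite mul_mx_diag mxE; apply: eq_bigr => i _.
by rewrite !mxE normCK mulrAC mulrC mulrA.
Qed.

(** The complexified matrix is Hermitian, hence unitarily diagonal with real
    diagonal; the least diagonal entry is the required eigenvalue.  It is an
    eigenvalue of the real matrix too, as having an eigenvector does not depend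
    on the field. *)
Lemma symmetric_least_eigenvalue (R : rcfType) n (M : 'M[R]_n) :
  (0 < n)%N -> M^T = M ->
  exists2 a, eigenvalue M a &
    forall v : 'rV_n, a * (v *m v^T) 0 0 <= (v *m M *m v^T) 0 0.
Proof.
move=> n0 Msym; pose N := map_mx (real_complex R) M.
have Nherm : N \is hermsymmx.
  apply: realsym_hermsym.
    by apply/is_hermitianmxP; rewrite expr0 scale1r map_mx_id // /N map_trmx Msym.
  by apply/mxOverP=> i j; rewrite mxE complex_real.
have /orthomx_spectralP NE := hermitian_normalmx Nherm.
have Dreal := hermitian_spectral_diag_real Nherm.
set P := spectralmx N in NE; set D := spectral_diag N in NE Dreal.
have Punit : P \is unitarymx := spectral_unitarymx N.
pose i0 := Ordinal n0.
case: (@Order.TotalTheory.arg_minP _ R 'I_n i0 xpredT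
  (fun i => complex.Re (D 0 i)) isT) => i _ imin.
have DE j : (complex.Re (D 0 j))%:C%C = D 0 j.
  by rewrite RRe_real // (mxOverP Dreal).
exists (complex.Re (D 0 i)).
  rewrite -(eigenvalue_map (real_complex R)) [X in eigenvalue _ X]DE; apply/eigenvalueP.
  exists (row i P); last first.
    (* a vanishing row would contradict the right inverse of P *)
    apply: contraTneq (spectral_unit N) => Pi0; apply/negP=> Pu.
    have := row_free_unit P; rewrite Pu => /row_freeP[Q PQ].
    move/rowP/(_ i): (congr1 (row i) PQ); rewrite row_mul Pi0 mul0mx !mxE eqxx.
    by move/esym/eqP; rewrite oner_eq0.
  rewrite -/N NE !mulmxA -[row i P *m _]row_mul mulmxV ?spectral_unit //.
  by rewrite -row_mul mul1mx row_diag_mx -scalemxAl -rowE.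
move=> v; rewrite -lecR rmorphM.
have toC (A : 'M[R]_n) : ((v *m A *m v^T) 0 0)%:C%C =
    (map_mx (real_complex R) v *m map_mx (real_complex R) A
       *m (map_mx (real_complex R) v) ^t*) 0 0.
  have -> : (map_mx (real_complex R) v) ^t* = map_mx (real_complex R) v^T.
    apply/matrixP=> x y; rewrite !mxE; by apply: conj_Creal; rewrite complex_real.
  by rewrite -!map_mxM [RHS]mxE.
(* the norm is the form of the identity matrix: both sides diagonalize in P *)
have <- : v *m 1%:M *m v^T = v *m v^T by rewrite mulmx1.
rewrite [X in _ * X]toC [leRHS]toC map_mx1 -/N.
set u := map_mx _ v; pose w := u *m P ^t*.
have wE : w ^t* = P *m u ^t* by rewrite /w trmx_mul map_mxM trmxCK.
have -> : u *m 1%:M *m u ^t* = w *m diag_mx (const_mx 1) *m w ^t*.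
  by rewrite diag_const_mx !mulmx1 wE /w mulmxA mulmxKtV.
have -> : u *m N *m u ^t* = w *m diag_mx D *m w ^t*.
  by rewrite wE /w -(invmx_unitary Punit) {1}NE !mulmxA.
rewrite !diag_formE mulr_sumr; apply: ler_sum => j _.
rewrite mxE mul1r -(DE j) ler_wpM2r ?exprn_ge0 // lecR.
exact: imin.
Qed.

End Spectral.

Lemma row_normE (R : realFieldType) n (v : 'rV[R]_n) :
  (v *m v^T) 0 0 = \sum_i v 0 i ^+ 2.
Proof. by rewrite mxE; apply: eq_bigr => i _; rewrite mxE. Qed.

Lemma row_norm_ge0 (R : realFieldType) n (v : 'rV[R]_n) : 0 <= (v *m v^T) 0 0.
Proof. by rewrite row_normE sumr_ge0 // => i _; apply: sqr_ge0. Qed.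

Lemma row_norm_eq0 (R : realFieldType) n (v : 'rV[R]_n) :
  (v *m v^T) 0 0 = 0 -> v = 0.
Proof.
rewrite row_normE => /eqP; rewrite psumr_eq0 => [/allP v0|i _]; last exact: sqr_ge0.
apply/rowP=> i; rewrite mxE; apply/eqP; rewrite -sqrf_eq0.
by have /implyP := v0 i (mem_index_enum i); apply.
Qed.

Lemma row_norm_gt0 (R : realFieldType) n (v : 'rV[R]_n) :
  v != 0 -> 0 < (v *m v^T) 0 0.
Proof.
move=> v0; rewrite lt_def row_norm_ge0 andbT.
by apply: contra_neq v0; apply: row_norm_eq0.
Qed.

(** An eigenvalue that bounds the quadratic form from below is below every
    other eigenvalue, so [min_eigenvalue] does not take its default value. *)
Lemma min_eigenvalueP (R : realType) n (M : 'M[R]_n) :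
  (0 < n)%N -> M^T = M ->
  eigenvalue M (min_eigenvalue M) /\
  forall v : 'rV_n, min_eigenvalue M * (v *m v^T) 0 0 <= (v *m M *m v^T) 0 0.
Proof.
move=> n0 Msym; have [a Ma aP] := symmetric_least_eigenvalue n0 Msym.
have ex : exists c, eigenvalue M c /\ forall b, eigenvalue M b -> c <= b.
  exists a; split=> // b /eigenvalueP[v vM v0]; have := aP v.
  by rewrite vM -scalemxAl [leRHS]mxE ler_pM2r ?row_norm_gt0.
have [Mm mP] := classical_sets.xgetPex 0 ex.
split=> // v; apply: le_trans (aP v).
by rewrite ler_wpM2r ?row_norm_ge0 ?mP.
Qed.

(** * Hodge Laplacians *)

Lemma hodge_sym (R : comPzRingType) n m p (d2 : 'M[R]_(n, m)) (d1 : 'M[R]_(p, n)) :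
  (d2 *m d2^T + d1^T *m d1)^T = d2 *m d2^T + d1^T *m d1.
Proof. by rewrite [LHS]raddfD /= !trmx_mul !trmxK. Qed.

(** If z = L y is a cycle, then applying d1 leaves d1 d1^T d1 y = 0 because
    d1 d2 = 0; so d1^T d1 y has norm 0 and z = d2 (d2^T y). *)
Lemma hodge_exact (R : realFieldType) n m p
    (d2 : 'M[R]_(n, m)) (d1 : 'M[R]_(p, n)) (z : 'cV[R]_n) :
  d1 *m d2 = 0 -> d2 *m d2^T + d1^T *m d1 \in unitmx -> d1 *m z = 0 ->
  exists y, z = d2 *m y.
Proof.
set L := _ + _ => d12 Lu d1z; pose y := invmx L *m z.
have zE : z = L *m y by rewrite mulKVmx.
pose w := d1^T *m (d1 *m y).
have zE' : z = d2 *m (d2^T *m y) + w by rewrite zE /L /w mulmxDl !mulmxA.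
have d1w : d1 *m w = 0.
  by move: d1z; rewrite zE' mulmxDr [d1 *m (d2 *m _)]mulmxA d12 mul0mx add0r.
have /row_norm_eq0 w0 : (w^T *m w^T^T) 0 0 = 0.
  by rewrite trmxK {1}/w trmx_mul trmxK -mulmxA d1w mulmx0 mxE.
exists (d2^T *m y); rewrite {1}zE'.
by rewrite -[w]trmxK w0 trmx0 addr0.
Qed.

(** * Weighted Cauchy-Schwarz *)

(** This is the bound of the norm of a positive semidefinite matrix by its
    absolute row sums, for the rank one matrix c c^T. *)
Lemma weighted_Cauchy_Schwarz (R : realFieldType) (I : finType) (P : pred I)
    (f c : I -> R) :
  (\sum_(i | P i) f i * c i) ^+ 2 <=
  (\sum_(i | P i) f i ^+ 2 * `|c i|) * \sum_(i | P i) `|c i|.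
Proof.
set B := (X in _ <= X).
have BE : B = \sum_(i | P i) \sum_(j | P j) f i ^+ 2 * `|c i| * `|c j|.
  by rewrite /B mulr_suml; apply: eq_bigr => i _; rewrite mulr_sumr.
(* B is split in two halves, to be symmetrized by exchanging i and j in one *)
have {1}-> : B = (B + B) / 2 by field.
rewrite {1}BE {1}BE [X in _ <= (_ + X) / _]exchange_big -big_split mulr_suml.
rewrite expr2 mulr_suml; apply: ler_sum => i _.
rewrite -big_split mulr_suml mulr_sumr; apply: ler_sum => j _ /=.
(* term by term: 2 x y <= x ^ 2 + y ^ 2 for x = |f i| and y = |f j|,
   weighted by |c i| |c j| *)
apply: le_trans (ler_norm _) _.
rewrite !normrM ler_pdivlMr // -[f i ^+ 2]real_normK ?num_real //.
rewrite -[f j ^+ 2]real_normK ?num_real //.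
rewrite -subr_ge0.
have -> : forall x y p q : R,
    x ^+ 2 * p * q + y ^+ 2 * q * p - x * p * (y * q) * 2 =
    (x - y) ^+ 2 * (p * q) by move=> x y p q; ring.
by rewrite mulr_ge0 ?sqr_ge0 ?mulr_ge0.
Qed.

(** * Incidence numbers *)

Section Incidence.

Variables (R : realType) (d : Order.disp_t) (T : finOrderType d).
Implicit Types (s t r : {set T}) (F G H X A : {set {set T}}).

Lemma norm_incidence_le s t : `|incidence R s t| <= (t \subset s)%:R.
Proof.
rewrite /incidence; case: (pickP (fun v => (v \in s) && (s :\ v == t))) => [v|no].
  case/andP=> vs /eqP <-; rewrite subsetDl (big_pred1 v) => [|u].
    by rewrite normrX normrN1 expr1n.
  apply/andP/eqP => [[us /eqP E]|-> //]; apply: contraTeq us => uv.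
  have : u \notin s :\ u by rewrite !inE eqxx.
  by rewrite E !inE uv.
by rewrite big_pred0 // normr0 ler0n.
Qed.

Lemma incidence_facet s t : incidence R s t != 0 -> t \subset s /\ #|s| = #|t|.+1.
Proof.
rewrite /incidence; case: (pickP (fun v => (v \in s) && (s :\ v == t))) => [v|no].
  by case/andP=> vs /eqP <- _; rewrite subsetDl (cardsD1 v s) vs.
by rewrite big_pred0 // eqxx.
Qed.

(** Deleting v and then u from s, or u and then v, gives opposite signs: the
    larger of the two loses one smaller vertex when the other goes first. *)
Lemma incidence_comp0 s t : \sum_r incidence R s r * incidence R r t = 0.
Proof.
pose e v s : R := (-1) ^+ #|[set u in s | (u < v)%O]|.
transitivity (\sum_v \sum_u (if [&& v \in s, u \in s, u != v & s :\ v :\ u == t]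
   then e v s * e u (s :\ v) else 0)).
  under eq_bigr => r _ do rewrite [incidence R s r]/incidence mulr_suml big_mkcondr.
  rewrite exchange_big big_mkcond; apply: eq_bigr => v _ /=.
  case: (v \in s); last by rewrite big1.
  rewrite -big_mkcond (big_pred1 (s :\ v)) => [|r]; last by rewrite eq_sym.
  rewrite /incidence mulr_sumr big_mkcond; apply: eq_bigr => u _.
  by rewrite !inE andbA [(u != v) && _]andbC -andbA.
set S := \sum_v _.
(* exchanging u and v changes the sign of each term *)
suff SN : S = - S.
  have : S *+ 2 == 0 by rewrite mulr2n {1}SN addNr.
  by rewrite mulrn_eq0 => /eqP.
rewrite {1}/S exchange_big /= /S -sumrN; apply: eq_bigr => v _.
rewrite -sumrN; apply: eq_bigr => u _.
rewrite setDDl [[set u] :|: _]setUC -setDDl eq_sym andbCA.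
case: ifP => [|_]; last by rewrite oppr0.
case/and4P=> vs us uv _.
wlog: u v us vs uv / (u < v)%O => [IH|ltuv].
  case: (ltgtP u v) => [|vu|E]; [exact: IH| | by rewrite E eqxx in uv].
  by rewrite [X in - X](IH v u) ?opprK // eq_sym.
have -> : e u (s :\ v) = e u s.
  congr (_ ^+ #|pred_of_set _|); apply/setP=> w; rewrite !inE.
  by case: eqVneq => // ->; rewrite lt_gtF ?andbF.
have -> : e v s = - e v (s :\ u).
  rewrite /e (cardsD1 u) !inE us ltuv exprS mulN1r; congr (- _ ^+ #|pred_of_set _|).
  by apply/setP=> w; rewrite !inE andbA.
by rewrite mulNr opprK mulrC.
Qed.

(** * Energies of chains *)

Definition chain_row F (f : {set T} -> R) : 'rV_#|F| := \row_j f (enum_val j).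

(** Chains are represented by functions on all sets, extended by 0, so that one
    function can be restricted to the faces of X and to the relative faces. *)
Lemma chain_row_surj F (v : 'rV[R]_#|F|) :
  exists2 f, v = chain_row F f & forall s, s \notin F -> f s = 0.
Proof.
exists (fun s => \sum_(j < #|F| | enum_val j == s) v 0 j) => [|s sF].
  apply/rowP=> i; rewrite mxE (big_pred1 i) // => j.
  by rewrite (inj_eq enum_val_inj).
rewrite big_pred0 // => j; apply: contraNF sF => /eqP <-; exact: enum_valP.
Qed.

Lemma chain_row_norm F f :
  (chain_row F f *m (chain_row F f)^T) 0 0 = \sum_(s in F) f s ^+ 2.
Proof. by rewrite mxE [RHS]big_enum_val; apply: eq_bigr => j _; rewrite !mxE. Qed.

Lemma chain_row_coboundary F G f :
  chain_row G f *m boundary_mx R F G =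
  chain_row F (fun s => \sum_(t in G) f t * incidence R s t).
Proof.
apply/rowP=> j; rewrite !mxE [RHS]big_enum_val; apply: eq_bigr => i _.
by rewrite !mxE.
Qed.

Lemma chain_row_boundary F G f :
  chain_row F f *m (boundary_mx R F G)^T =
  chain_row G (fun t => \sum_(s in F) f s * incidence R s t).
Proof.
apply/rowP=> j; rewrite !mxE [RHS]big_enum_val; apply: eq_bigr => i _.
by rewrite !mxE.
Qed.

Definition hodge_energy F G H f : R :=
  \sum_(s in F) (\sum_(t in G) f t * incidence R s t) ^+ 2 +
  \sum_(t in H) (\sum_(s in G) f s * incidence R s t) ^+ 2.

Lemma hodge_energyE F G H f :
  (chain_row G f *m (boundary_mx R F G *m (boundary_mx R F G)^T
      + (boundary_mx R G H)^T *m boundary_mx R G H) *m (chain_row G f)^T) 0 0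
  = hodge_energy F G H f.
Proof.
have sq m n (u : 'rV[R]_m) (B : 'M[R]_(m, n)) :
    u *m (B *m B^T) *m u^T = (u *m B) *m (u *m B)^T.
  by rewrite trmx_mul !mulmxA.
rewrite mulmxDr mulmxDl mxE sq -{2}[boundary_mx R G H]trmxK sq.
by rewrite chain_row_coboundary chain_row_boundary !chain_row_norm.
Qed.

(** The intermediate faces between a face t outside A and a face s of X are in
    X since s is, and outside A since t is, so that the relative composition
    misses no term of the absolute one. *)
Lemma relboundary_comp0 X A k : simplicial_complex X -> simplicial_complex A ->
  relboundary R X A k *m relboundary R X A k.+1 = 0.
Proof.
move=> [_ clX] [_ clA]; apply/matrixP=> i j; rewrite !mxE.
transitivity (\sum_(r in relfaces X A k.+1)
    incidence R (enum_val j) r * incidence R r (enum_val i)).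
  by rewrite [RHS]big_enum_val; apply: eq_bigr => r _; rewrite !mxE mulrC.
have := enum_valP j; have := enum_valP i.
move: (enum_val i) (enum_val j) => t s tk sk.
rewrite -[RHS](incidence_comp0 s t) big_mkcond; apply: eq_bigr => r _ /=.
case: ifPn => // rk.
have [->|nzs] := eqVneq (incidence R s r) 0; first by rewrite mul0r.
have [->|nzt] := eqVneq (incidence R r t) 0; first by rewrite mulr0.
have [tr rt] := incidence_facet nzt; have [rs _] := incidence_facet nzs.
move: tk sk rk; rewrite !inE rt eqSS => /andP[tA /andP[_ tk]] /andP[_ /andP[sX _]].
rewrite tk (clX s r) //= !andbT negbK => rA.
by move: tA; rewrite tk andbT (clA r t).
Qed.

(** * Comparison of the absolute and relative energies *)

Section Compare.

Variables (X A : {set {set T}}) (k : nat).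
Hypotheses (hA : simplicial_complex A) (hAX : A \subset X).

Lemma sum_faces_split n (F : {set T} -> R) :
  \sum_(s in faces X n) F s =
  \sum_(s in relfaces X A n) F s + \sum_(s in faces A n) F s.
Proof.
rewrite (big_setID (faces A n)) addrC; congr (_ + _).
apply: eq_bigl => s; rewrite !inE; case sA: (s \in A); rewrite ?andbF //.
by rewrite (subsetP hAX) //; case: eqP.
Qed.

Definition face_degree F t : nat := #|[set s in F | t \subset s]|.

(** The left side is the absolute row sum of s in B^T B: it counts the pairs of
    a facet t of s in A and a relative face r that contains t.  The pairs with
    r = s give the facets of s in A.  If r differs from s, then t has to be the
    intersection of r and s for reasons of dimension, so each r occurs once. *)
Lemma overlap_bound s : s \in relfaces X A k.+1 ->
  (\sum_(t in faces A k | t \subset s) face_degree (relfaces X A k.+1) t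
     <= max_overlap X A k)%N.
Proof.
move=> sS; apply: leq_trans (leq_bigmax_cond _ sS).
set S := relfaces X A k.+1 in sS *.
have cardS r : r \in S -> #|r| = k.+1 by rewrite !inE => /andP[_ /andP[_ /eqP]].
clearbody S.
have degE t : t \subset s ->
    face_degree S t = (1 + \sum_(r in S) ((r != s) && (t \subset r)))%N.
  move=> ts; rewrite /face_degree (cardsD1 s) !inE sS ts -sum1_card; congr (_ + _)%N.
  rewrite big_mkcond [RHS]big_mkcond; apply: eq_bigr => r _; rewrite !inE.
  by case: (r == s); case: (r \in S); case: (t \subset r).
under eq_bigr => t /andP[_ ts] do rewrite degE //.
rewrite big_split /= sum1dep_card exchange_big /=; apply: leq_add.
  apply/subset_leq_card/subsetP=> t; rewrite !inE => /andP[/andP[tA tk] ts].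
  by rewrite tA tk ts (subsetP hAX).
rewrite -sum1dep_card [leqRHS]big_mkcondr; apply: leq_sum => r rS.
rewrite [leqRHS](_ : _ = \sum_(t | t == r :&: s) (t \in faces A k))%N; last first.
  by rewrite big_pred1_eq.
rewrite [leqRHS]big_mkcond [leqLHS]big_mkcond.
apply: leq_sum => t _; case: andP => // -[tA ts].
case: eqVneq => //= rs; case tr: (t \subset r) => //.
suff <- : t = r :&: s by rewrite eqxx tA.
apply/eqP; rewrite eqEcard subsetI tr ts /=.
have -> : #|t| = k by move: tA; rewrite inE => /andP[_ /eqP].
rewrite -ltnS -(cardS r rS); apply: proper_card.
rewrite properEneq subsetIl andbT; apply: contra rs => /eqP/setIidPl rs.
by rewrite eqEcard rs !cardS //= leqnn.
Qed.

(** The left side is the form of B^T B.  Weighted Cauchy-Schwarz bounds each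
    square by the squares of f on the faces around t, times their number; the
    total coefficient of each square of f is then an absolute row sum. *)
Lemma sum_overlap_le f :
  \sum_(t in faces A k) (\sum_(s in relfaces X A k.+1) f s * incidence R s t) ^+ 2
  <= (max_overlap X A k)%:R * \sum_(s in relfaces X A k.+1) f s ^+ 2.
Proof.
set S := relfaces X A k.+1.
pose b s t : R := (t \subset s)%:R.
apply: (@le_trans _ _ (\sum_(t in faces A k) \sum_(s in S)
    f s ^+ 2 * (b s t * (face_degree S t)%:R))).
  apply: ler_sum => t _; apply: le_trans (weighted_Cauchy_Schwarz _ _ _) _.
  under [leRHS]eq_bigr => s _ do rewrite mulrA.
  rewrite -mulr_suml; apply: ler_pM.
  - by apply: sumr_ge0 => s _; rewrite mulr_ge0 ?sqr_ge0.
  - exact: sumr_ge0.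
  - by apply: ler_sum => s _; rewrite ler_wpM2l ?sqr_ge0 ?norm_incidence_le.
  - rewrite /face_degree -sum1dep_card natr_sum big_mkcondr.
    apply: ler_sum => s _; apply: le_trans (norm_incidence_le _ _) _.
    by case: (_ \subset _).
rewrite exchange_big mulr_sumr; apply: ler_sum => s sS /=.
rewrite -mulr_sumr mulrC ler_wpM2r ?sqr_ge0 //.
apply: le_trans (_ : (\sum_(t in faces A k | t \subset s) face_degree S t)%:R <= _).
  rewrite natr_sum big_mkcondr; apply: ler_sum => t _.
  by rewrite /b; case: (_ \subset _); rewrite ?mul1r ?mul0r.
by rewrite ler_nat overlap_bound.
Qed.

(** As f vanishes on A, only the squares of faces of A can differ.  Those of
    faces of dimension k + 1 vanish, since the facets of such a face are in A. *)
Lemma hodge_energy_compare f : (forall s, s \notin relfaces X A k.+1 -> f s = 0) ->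
  hodge_energy (faces X k.+2) (faces X k.+1) (faces X k) f =
  hodge_energy (relfaces X A k.+2) (relfaces X A k.+1) (relfaces X A k) f +
  \sum_(t in faces A k) (\sum_(s in relfaces X A k.+1) f s * incidence R s t) ^+ 2.
Proof.
move=> f0.
have restr (F : {set T} -> R) : \sum_(s in faces X k.+1) f s * F s =
    \sum_(s in relfaces X A k.+1) f s * F s.
  rewrite sum_faces_split [X in _ + X]big1 ?addr0 // => s sA.
  by rewrite f0 ?mul0r // inE sA.
rewrite /hodge_energy !sum_faces_split [X in _ + X + _]big1 => [|s sA]; last first.
  rewrite restr big1 ?expr0n // => t tS.
  have [|nz] := eqVneq (incidence R s t) 0; first by move=> ->; rewrite mulr0.
  have [ts _] := incidence_facet nz.
  move: tS sA; rewrite !inE => /andP[tA /andP[_ tk]] /andP[sA _].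
  by move: tA; rewrite tk andbT (hA.2 s t).
rewrite addr0 addrA; congr (_ + _ + _); apply: eq_bigr => s _; by rewrite restr.
Qed.

Lemma rellaplacian_form_ge (v : 'rV[R]_#|relfaces X A k.+1|) :
  relfaces X A k.+1 != set0 ->
  (mu R X k - (max_overlap X A k)%:R) * (v *m v^T) 0 0
    <= (v *m rellaplacian R X A k *m v^T) 0 0.
Proof.
move=> hne; have [f -> f0] := chain_row_surj v.
have X_gt0 : (0 < #|faces X k.+1|)%N.
  have [s /setDP[sX _]] := set0Pn _ hne; by apply/card_gt0P; exists s.
have [_ /(_ (chain_row (faces X k.+1) f))] :=
  min_eigenvalueP X_gt0 (hodge_sym (boundary R X k.+1) (boundary R X k)).
rewrite -/(laplacian R X k) -/(mu R X k) /laplacian /rellaplacian.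
rewrite !hodge_energyE !chain_row_norm hodge_energy_compare //.
rewrite sum_faces_split [X in _ + X]big1 => [|s sA]; last first.
  by rewrite f0 ?expr0n // inE sA.
rewrite addr0 mulrBl lerBlDr => /le_trans; apply.
by rewrite lerD2l sum_overlap_le.
Qed.

End Compare.

End Incidence.

(** * The eigenvalue bound and vanishing of relative homology *)

Theorem theorem1p10 (R : realType) (d : Order.disp_t) (T : finOrderType d)
    (X A : {set {set T}}) (k : nat)
    (hX : simplicial_complex X) (hA : simplicial_complex A)
    (hAX : A \subset X) (hk : (1 <= k)%N)
    (hne : relfaces X A k.+1 != set0) :
  mu R X k - (max_overlap X A k)%:R <= relmu R X A k /\
  ((max_overlap X A k)%:R < mu R X k ->
   forall h : relhomology R X A k, h = 0).
Proof.
have form_ge := @rellaplacian_form_ge R d T X A k hA hAX _ hne.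
split.
  have S_gt0 : (0 < #|relfaces X A k.+1|)%N by rewrite card_gt0.
  have [/eigenvalueP[v vL v0] _] := min_eigenvalueP S_gt0
    (hodge_sym (relboundary R X A k.+1) (relboundary R X A k)).
  rewrite -(ler_pM2r (row_norm_gt0 v0)); apply: le_trans (form_ge v) _.
  by rewrite /rellaplacian vL -scalemxAl mxE.
move=> mu_gt; have Lunit : rellaplacian R X A k \in unitmx.
  rewrite -row_free_unit; apply: inj_row_free => v vL.
  apply: contraTeq (form_ge v) => v0; rewrite vL mul0mx [leRHS]mxE -ltNge.
  by rewrite mulr_gt0 ?row_norm_gt0 ?subr_gt0.
elim/quotW=> z.
have /eqP dz : relboundary R X A k *m vsval z == 0.
  by have := subvsP z; rewrite memv_ker lfunE.
have [y zE] := hodge_exact (relboundary_comp0 R k hX hA) Lunit dz.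
rewrite -(raddf0 (\pi_(relhomology R X A k)%qT)); apply/eqP.
rewrite -Quotient.idealrBE subr0 inE zE -[_ *m y](lfunE (mulmx _)).
exact/memv_img/memvf.
Qed.
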